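(* Let $G$ be a simple graph with vertex set $[d]$, $d\ge1$, and let $K_G$ be its coloring ideal in the ring $R$. For every integer $n\ge0$ there is a one-to-one correspondence (bijection) between the $(n+1)$-colorings of $G$ and the monomials of degree $n$ in $K_G$.
   Context: $G$ is a simple graph with vertex set $[d]$. An $m$-coloring of $G$ is a map $\phi:[d]\to[m]$ (not necessarily surjective) with $\phi(x)\neq\phi(y)$ for adjacent $x,y$. For $\pi=a_1\cdots a_d\in\mathcal S_d$ and $k\in[d]$, $\ell(k)$ is the largest $r\ge0$ such that there are indices $i_0<\cdots<i_r=k$ with $a_{i_{s-1}}$ adjacent to $a_{i_s}$ in $G$ for all $s$. An integer $k\in\{0,\dots,d-1\}$ is a cut of $\pi$ if $k=0$, or $\ell(k)<\ell(k+1)$, or $\ell(k)=\ell(k+1)$ and $a_k<a_{k+1}$. If the cuts are $0=i_1<\cdots<i_q$, the $G$-sequence of $\pi$ is $S_1,\dots,S_q$ with $S_j=\{a_{i_j+1},\dots,a_{i_{j+1}}\}$ for $j<q$ and $S_q=\{a_{i_q+1},\dots,a_d\}$; the short $G$-sequence is $S_1,\dots,S_{q-1}$. Let $\mathbb k$ be a field, $A=\mathbb k[x_S : S\subseteq[d]]$ (one variable for each subset of $[d]$, each of degree $1$), $I$ the ideal of $A$ generated by all $x_Sx_T$ with $S\not\subseteq T$ and $T\not\subseteq S$, and $R=A/I$ (the face ring of the order complex of the Boolean algebra on $d$ atoms). The (nonzero) monomials of $R$ are the $x_{S_1}^{e_1}\cdots x_{S_k}^{e_k}$ with $S_1\subsetneq\cdots\subsetneq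 S_k$. A basic coloring monomial for $G$ is a monomial $x_{S_1}x_{S_2}\cdots x_{S_k}$ ($k\ge0$) with $\emptyset\subsetneq S_1\subsetneq\cdots\subsetneq S_k\subsetneq[d]$ such that some $\pi\in\mathcal S_d$ has short $G$-sequence $S_1,S_2\setminus S_1,\dots,S_k\setminus S_{k-1}$. A coloring monomial is a nonzero monomial of $R$ divisible by a basic coloring monomial. The coloring ideal $K_G$ is the ideal of $R$ generated by the coloring monomials (equivalently by the basic ones); its monomials of degree $n$ are the coloring monomials of degree $n$. *)

(* Defs.v *)
From HB Require Import structures.
From mathcomp Require Import all_boot all_order all_algebra perm.
From mathcomp Require Import boolp classical_sets functions.
From mathcomp.multinomials Require Import mpoly.

Set Implicit Arguments.
Unset Strict Implicit.
Unset Printing Implicit Defensive.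

Import GRing.Theory.
Local Open Scope ring_scope.
Local Open Scope quotient_scope.

(* The vertex set {1, ..., d} is represented by 'I_d = {0, ..., d-1} with its
   order, and a graph by its adjacency relation e.  A word a_1 ... a_d is a
   permutation pi of 'I_d, with a_k = pi (k - 1): positions are also shifted by
   one, so the letter a_k sits at position k - 1. *)

Section Coloring.
Variables (d : nat) (e : rel 'I_d).

Definition is_coloring (m : nat) (phi : {ffun 'I_d -> 'I_m}) : Prop :=
  forall x y, e x y -> phi x != phi y.

Definition chain_step (pi : 'S_d) : rel 'I_d :=
  [rel i j : 'I_d | (i < j)%N && e (pi i) (pi j)].

(* The index r of a chain i_0 < ... < i_r = k of positions is always < d, so
   bounding it loses nothing. *)
Definition ell (pi : 'S_d) (k : 'I_d) : nat :=
  \max_(r < d | [exists i0 : 'I_d, exists t : r.-tuple 'I_d,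
                  path (chain_step pi) i0 t && (last i0 t == k)]) r.

(* k is an unshifted index in {0, ..., d-1}: a cut separates a_k from a_(k+1),
   which sit at the positions j = k - 1 and k. *)
Definition is_cut (pi : 'S_d) (k : 'I_d) : bool :=
  (k == 0 :> nat)%N ||
  [exists j : 'I_d, (j.+1 == k :> nat) &&
     ((ell pi j < ell pi k)%N ||
      (ell pi j == ell pi k) && (pi j < pi k)%N)].

Definition cuts (pi : 'S_d) : seq nat :=
  [seq val k | k <- enum 'I_d & is_cut pi k].

(* {a_(i+1), ..., a_j} *)
Definition block (pi : 'S_d) (i j : nat) : {set 'I_d} :=
  [set pi p | p : 'I_d & (i <= p < j)%N].

Definition Gseq (pi : 'S_d) : seq {set 'I_d} :=
  [seq block pi p.1 p.2 | p <- zip (cuts pi) (rcons (behead (cuts pi)) d)].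

Definition short_Gseq (pi : 'S_d) : seq {set 'I_d} :=
  take (size (Gseq pi)).-1 (Gseq pi).

End Coloring.

Definition ideal_gen (R : comNzRingType) (X : set R) : set R :=
  [set y | exists s : seq (R * R),
     (forall p, p \in s -> X p.2) /\ y = \sum_(p <- s) p.1 * p.2].

Section FaceRing.
Variables (k : fieldType) (d : nat).

(* The variables of multinomials are indexed by ordinals: x_S is the variable
   of index enum_rank S. *)
Definition nvars := #|{set 'I_d}|.
Definition subset_poly := {mpoly k[nvars]}.
Definition pvar (S : {set 'I_d}) : subset_poly := 'X_(enum_rank S).

Definition face_gens : set subset_poly :=
  [set a | exists S T : {set 'I_d},
     [/\ ~~ (S \subset T), ~~ (T \subset S) & a = pvar S * pvar T]].

(* Membership in the ideal I, made boolean as ring_quotient requires. *)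
Definition face_ideal : {pred subset_poly} :=
  fun a => `[< ideal_gen face_gens a >].

Lemma face_ideal_closed : idealr_closed face_ideal.
Proof.
split.
- by apply/asboolP; exists [::]; rewrite big_nil.
- apply/asboolP => -[s [sX s1]].
  have /eqP := congr1 (mcoeff 0%MM) s1.
  rewrite mcoeff1 eqxx raddf_sum /= big_seq big1 ?oner_eq0 // => p.
  move=> /sX [S [T [_ _ ->]]].
  rewrite !rmorphM /=.
  rewrite /pvar mcoeffX.
  rewrite mnm1_eq0.
  by rewrite mul0r mulr0.
- move=> a u v /asboolP[su [suX ->]] /asboolP[sv [svX ->]]; apply/asboolP.
  exists ([seq (a * p.1, p.2) | p <- su] ++ sv); split.
    by move=> p; rewrite mem_cat => /orP[/mapP[q /suX qX ->]|/svX].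
  rewrite big_cat big_map mulr_sumr /=; congr (_ + _).
  by apply: eq_bigr => p _; rewrite mulrA.
Qed.

HB.instance Definition _ := isIdealr.Build subset_poly face_ideal face_ideal_closed.

Definition face_ring := {ideal_quot face_ideal}.

Definition face_proj (a : subset_poly) : face_ring := \pi_face_ring a.

Definition xvar (S : {set 'I_d}) : face_ring := face_proj (pvar S).

Definition is_monomial (n : nat) (r : face_ring) : Prop :=
  r != 0 /\
  exists m : 'X_{1..nvars}, mdeg m = n /\ r = face_proj 'X_[m].

Variable e : rel 'I_d.

Definition basic_coloring_monomial (r : face_ring) : Prop :=
  exists s : seq {set 'I_d},
    [/\ path (fun S T : {set 'I_d} => S \proper T) finset.set0 (rcons s [set: 'I_d]%SET),
        exists pi : 'S_d,
          short_Gseq e pi = pairmap (fun S T : {set 'I_d} => T :\: S) finset.set0 s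
      & r = \prod_(S <- s) xvar S].

Definition coloring_monomial (r : face_ring) : Prop :=
  (exists n, is_monomial n r) /\
  exists b c, basic_coloring_monomial b /\ r = b * c.

Definition coloring_ideal : set face_ring := ideal_gen coloring_monomial.

End FaceRing.

(* Main.v *)
(* A multiset of n subsets forming a chain S_0 <= ... <= S_(n-1) is the same as
   an arbitrary map phi : [d] -> {0, ..., n}, via S_j = {v | phi v <= j}.  Under
   this identification the chain is divisible by a basic coloring monomial
   exactly when phi is a coloring.  If phi is a coloring, sort the vertices by
   increasing color, breaking ties by decreasing (rank, label), where the rank
   is the length of the longest color-increasing path ending at the vertex:
   rank then agrees with ell, so that cuts only occur where the color jumps.
   Conversely (ell, letter) decreases between consecutive cuts while ell
   increases along every edge, so that the cut sets of a word separate
   adjacent vertices. *)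

Require Import Defs.
From mathcomp.multinomials Require Import mpoly.
From mathcomp Require Import all_boot all_order all_algebra.
From mathcomp Require Import boolp classical_sets functions.
From mathcomp Require Import fintype finset perm zify.

Set Implicit Arguments.
Unset Strict Implicit.
Unset Printing Implicit Defensive.

Import GRing.Theory.

(** * Differences of nested sets, and sorting permutations *)

Lemma take_map_zip (T U : Type) (F : T -> T -> U) x y c :
  take (size c) [seq F p.1 p.2 | p <- zip (x :: c) (rcons c y)] =
  pairmap F x c.
Proof. by elim: c x => [|z c IH] x //=; rewrite IH. Qed.

(** Each set is the union of its predecessor and their difference, so the sequence is rebuilt from
    [S0] one set at a time. *)
Lemma pairmap_setD_inj (T : finType) (S0 : {set T}) s s' :
  path (fun S T : {set T} => S \subset T) S0 s ->
  path (fun S T : {set T} => S \subset T) S0 s' ->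
  pairmap (fun S T => T :\: S)%SET S0 s = pairmap (fun S T => T :\: S)%SET S0 s' ->
  s = s'.
Proof.
elim: s S0 s' => [|S s IH] S0 [|S' s'] //= /andP[sS ps] /andP[sS' ps'] [eqD].
have eqS : S = S'.
  rewrite -(setID S S0) -(setID S' S0) eqD.
  by rewrite (setIidPr sS) (setIidPr sS').
move=> eqs; rewrite -{}eqS in ps' eqs *.
by congr (_ :: _); apply: IH eqs.
Qed.

Lemma exists_sorting_perm (d : nat) (R : rel 'I_d) :
  total R -> transitive R ->
  exists pi : 'S_d, forall i j : 'I_d, i < j -> R (pi i) (pi j).
Proof.
move=> totR trR.
have sz : size (sort R (enum 'I_d)) == d by rewrite size_sort size_enum_ord.
pose t := Tuple sz.
have inj_t : injective (tnth t).
  by apply/tuple_uniqP; rewrite sort_uniq enum_uniq.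
exists (perm inj_t) => i j ltij; rewrite !permE !(tnth_nth i).
apply: (sorted_ltn_nth trR) => //; last 2 first.
- by rewrite inE size_tuple.
- by rewrite inE size_tuple.
exact: sort_sorted.
Qed.

(** * Words, their cuts and cut sets *)

Section Words.
Variables (d : nat) (e : rel 'I_d).
Implicit Types (pi : 'S_d) (i j k : 'I_d).

Lemma in_block pi a b x : (x \in block pi a b) = (a <= (pi^-1)%g x < b).
Proof. by rewrite -{1}(permKV pi x) mem_imset ?inE //; exact: perm_inj. Qed.

Lemma block_full pi : block pi 0 d = [set: 'I_d]%SET.
Proof. by apply/setP => x; rewrite in_block inE ltn_ord. Qed.

Lemma block_empty pi : block pi 0 0 = set0.
Proof. by apply/setP => x; rewrite in_block inE ltn0. Qed.

Lemma block_setD pi a b : (block pi 0 b :\: block pi 0 a)%SET = block pi a b.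
Proof. by apply/setP => x; rewrite !(in_block, inE) -leqNgt. Qed.

Lemma block_proper pi a b : a < b <= d -> block pi 0 a \proper block pi 0 b.
Proof.
case/andP=> ltab lebd; apply/properP; split.
  by apply/subsetP => x; rewrite !in_block /= => /ltn_trans; apply.
exists (pi (Ordinal (leq_trans ltab lebd))); rewrite in_block permK //=.
by rewrite ltnn.
Qed.

Lemma chain_step_size pi i t :
  path (chain_step e pi) i t -> i + size t <= last i t.
Proof.
elim: t i => [|j t IH] i /=; first by rewrite addn0.
case/andP=> /andP[ltij _] /IH; lia.
Qed.

(** A longest chain ending at [i] extends by [j]. Positions strictly increase along a chain, so the
    longer chain still has index below [d] and is counted by [ell]. *)
Lemma ell_lt pi i j : i < j -> e (pi i) (pi j) -> ell e pi i < ell e pi j.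
Proof.
move=> ltij eij; have d_gt0 : 0 < d by apply: leq_ltn_trans (ltn_ord i).
rewrite {1}/ell.
have [|r /existsP[i0 /existsP[t /andP[pt /eqP lt_i]]] ->] := @eq_bigmax_cond
  'I_d [pred r : 'I_d | [exists i0 : 'I_d, exists t : r.-tuple 'I_d,
    path (chain_step e pi) i0 t && (last i0 t == i)]] val.
  (* The one-term chain makes the index set nonempty, so the maximum is attained. *)
  apply/card_gt0P; exists (Ordinal d_gt0); rewrite inE /=.
  by apply/existsP; exists i; apply/existsP; exists [tuple]; rewrite /= eqxx.
have pt' : path (chain_step e pi) i0 (rcons t j).
  by rewrite rcons_path pt lt_i /=; apply/andP.
have lt_rd : r.+1 < d.
  have := chain_step_size pt'.
  rewrite last_rcons size_rcons size_tuple => le_j.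
  by apply: leq_ltn_trans (ltn_ord j); apply: leq_trans le_j; apply: leq_addl.
apply: (@leq_bigmax_cond 'I_d _ val (Ordinal lt_rd)).
apply/existsP; exists i0; apply/existsP; exists [tuple of rcons t j].
by rewrite pt' last_rcons /=.
Qed.

(** Where there is no cut, [ell] does not increase from one position to the next. *)
Lemma exists_cut pi i j :
  i < j -> ell e pi i < ell e pi j ->
  exists2 c : 'I_d, is_cut e pi c & i < c <= j.
Proof.
move=> ltij; apply: contraPP => nocut; apply/negP; rewrite -leqNgt.
have noc (c : 'I_d) : i < c <= j -> ~~ is_cut e pi c.
  by move=> ijc; apply/negP => cc; apply: nocut; exists c.
have le_ell m (ltmd : m < d) : i <= m <= j -> ell e pi (Ordinal ltmd) <= ell e pi i.
  elim: m ltmd => [|m IH] ltmd /andP[im mj].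
    by rewrite (_ : Ordinal ltmd = i) //; apply: val_inj => /=; lia.
  case: (ltngtP i m.+1) im => // [ltim|eqim] _; last first.
    by rewrite (_ : Ordinal ltmd = i) //; apply: val_inj.
  have ltmd' : m < d by apply: ltnW.
  apply: leq_trans (IH ltmd' _); last by rewrite -ltnS ltim ltnW.
  have := noc (Ordinal ltmd); rewrite /= ltim mj => /(_ isT).
  rewrite negb_or => /andP[_ /existsPn/(_ (Ordinal ltmd'))] /=.
  by rewrite eqxx /= negb_or -leqNgt => /andP[].
have := le_ell j (ltn_ord j); rewrite leqnn (ltnW ltij) => /(_ isT).
by congr (ell _ _ _ <= _); apply: val_inj.
Qed.

Lemma cuts_cons pi : 0 < d -> cuts e pi = 0 :: behead (cuts e pi).
Proof.
case: d e pi => [|d'] e' pi // _.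
by rewrite /cuts enum_ordSl.
Qed.

Lemma path_cuts pi : 0 < d -> path ltn 0 (behead (cuts e pi)).
Proof.
move=> d_gt0; have : sorted ltn (cuts e pi).
  apply: (@subseq_sorted _ ltn ltn_trans _ (iota 0 d)); last exact: iota_ltn_sorted.
  by rewrite -val_enum_ord; apply: map_subseq; apply: filter_subseq.
by rewrite {1}(cuts_cons pi d_gt0).
Qed.

Lemma mem_cuts pi c :
  (c \in cuts e pi) = [exists k : 'I_d, is_cut e pi k && (val k == c)].
Proof.
apply/mapP/existsP => [[k]|[k /andP[kc /eqP <-]]].
  by rewrite mem_filter => /andP[kc _] ->; exists k; rewrite kc eqxx.
by exists k; rewrite // mem_filter kc mem_enum.
Qed.

Lemma mem_behead_cuts pi c : 0 < d ->
  (c \in behead (cuts e pi)) = (0 < c) && (c \in cuts e pi).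
Proof.
move=> d_gt0; have := path_cuts pi d_gt0.
rewrite {3}(cuts_cons pi d_gt0) inE.
rewrite (path_sortedE ltn_trans) => /andP[/allP pos _].
by case: c => [|c] //=; apply/negP => /pos.
Qed.

(** These initial segments of the word are the partial unions of its short G-sequence. The cut 0 is
    left out because its segment is empty. *)
Definition cut_sets pi : seq {set 'I_d} :=
  [seq block pi 0 c | c <- behead (cuts e pi)].

Lemma path_cut_sets pi : 0 < d ->
  path (fun S T : {set 'I_d} => S \proper T) set0
    (rcons (cut_sets pi) [set: 'I_d]%SET).
Proof.
move=> d_gt0; rewrite -(block_empty pi) -(block_full pi) -map_rcons path_map.
have le_d : all (fun c => c <= d) (rcons (behead (cuts e pi)) d).
  rewrite all_rcons leqnn /=; apply/allP => c; rewrite mem_behead_cuts //.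
  rewrite mem_cuts => /andP[_ /existsP[k /andP[_ /eqP <-]]].
  exact: ltnW (ltn_ord k).
have p_lt : path ltn 0 (rcons (behead (cuts e pi)) d).
  rewrite rcons_path path_cuts //=.
  have := mem_last 0 (behead (cuts e pi)); rewrite -cuts_cons // mem_cuts.
  by case/existsP=> k /andP[_ /eqP <-]; apply: ltn_ord.
apply: (@sub_in_path _ (fun c => c <= d)) p_lt; last by rewrite /= le_d.
by move=> a b _ bd ab; apply: block_proper; apply/andP.
Qed.

(** Each block is the difference of two consecutive initial segments; the last block, ending at [d],
    is the one that [short_Gseq] drops. *)
Lemma short_GseqE pi : 0 < d ->
  short_Gseq e pi = pairmap (fun S T => T :\: S)%SET set0 (cut_sets pi).
Proof.
move=> d_gt0; rewrite /short_Gseq /Gseq (cuts_cons pi d_gt0) /cut_sets /=.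
rewrite size_map size_zip /= size_rcons minnn take_map_zip -(block_empty pi).
have pairE a c : pairmap (block pi) a c =
    pairmap (fun S T => T :\: S)%SET (block pi 0 a) (map (block pi 0) c).
  by elim: c a => //= b c IH a; rewrite IH block_setD.
exact: pairE.
Qed.

(** The hypothesis says that cut sets are unions of color classes. Since [ell] increases along an
    edge, some cut set contains only the earlier end, so the two ends cannot share a color. *)
Lemma coloring_of_cut_sets m (phi : {ffun 'I_d -> 'I_m}) pi :
  symmetric e -> irreflexive e ->
  (forall S x y, S \in cut_sets pi -> phi x = phi y -> (x \in S) = (y \in S)) ->
  is_coloring e phi.
Proof.
move=> e_sym e_irr sepS; suff wlogP x y : (pi^-1)%g x < (pi^-1)%g y -> e x y ->
    phi x != phi y.
  move=> x y exy; case: (ltngtP ((pi^-1)%g x) ((pi^-1)%g y)) => [ltxy|ltyx|eqxy].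
  - exact: wlogP.
  - by rewrite eq_sym wlogP // e_sym.
  - by move/val_inj/perm_inj: eqxy exy => ->; rewrite e_irr.
move=> ltxy exy; apply/eqP => eq_phi.
have /(exists_cut ltxy)[c cut_c /andP[ltc lec]] :
    ell e pi ((pi^-1)%g x) < ell e pi ((pi^-1)%g y).
  by apply: ell_lt; rewrite // !permKV.
have S_c : block pi 0 c \in cut_sets pi.
  apply: map_f; rewrite mem_behead_cuts ?(leq_trans _ ltc) //; last first.
    exact: leq_ltn_trans (ltn_ord x).
  by rewrite mem_cuts; apply/existsP; exists c; rewrite cut_c eqxx.
by have := sepS _ _ _ S_c eq_phi; rewrite !in_block /= ltc ltnNge lec.
Qed.

(** * The word sorted by a coloring *)

Section Coloring.
Variables (m : nat) (phi : {ffun 'I_d -> 'I_m}).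

Definition color_step : rel 'I_d := [rel x y | e x y && (phi x < phi y)].

Definition color_rank (v : 'I_d) : nat :=
  \max_(r < d | [exists v0 : 'I_d, exists t : r.-tuple 'I_d,
                  path color_step v0 t && (last v0 t == v)]) r.

(** Within one color both tie-breakers decrease, opposite to the increase that [is_cut] requires. *)
Definition color_order : rel 'I_d :=
  fun u v => (phi u < phi v) || (phi u == phi v :> nat) &&
    ((color_rank v < color_rank u) ||
     (color_rank v == color_rank u) && (v <= u)).

Lemma color_order_total : total color_order.
Proof. by move=> u v; rewrite /color_order; lia. Qed.

Lemma color_order_trans : transitive color_order.
Proof. by move=> u v w; rewrite /color_order; lia. Qed.

Hypothesis phi_col : is_coloring e phi.
Variable pi : 'S_d.
Hypothesis pi_sorted : forall i j : 'I_d, i < j -> color_order (pi i) (pi j).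

(** The ends of an edge have distinct colors, so [color_order] compares them by color alone. *)
Lemma color_stepE i j : color_step (pi i) (pi j) = chain_step e pi i j.
Proof.
rewrite /color_step /chain_step /= andbC; case eij: (e _ _); rewrite ?(andbF, andbT) //.
have nij := phi_col eij; apply/idP/idP; last first.
  by move/pi_sorted; rewrite /color_order; move: nij; rewrite -val_eqE /=; lia.
apply: contraTT; rewrite -!leqNgt leq_eqVlt => /orP[/eqP/val_inj -> //|].
by move/pi_sorted; rewrite /color_order; lia.
Qed.

Lemma color_rankE k : color_rank (pi k) = ell e pi k.
Proof.
apply: eq_bigl => r; apply/existsP/existsP => -[i0 /existsP[t /andP[pt /eqP lt]]].
  exists ((pi^-1)%g i0); apply/existsP; exists (map_tuple (pi^-1)%g t).
  rewrite last_map lt permK eqxx andbT path_map.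
  by apply: sub_path pt => x y /=; rewrite -color_stepE !permKV.
exists (pi i0); apply/existsP; exists (map_tuple pi t).
rewrite last_map lt eqxx andbT path_map.
by apply: sub_path pt => x y /=; rewrite -color_stepE.
Qed.

(** The rank equals [ell], so a cut between letters of equal color would contradict the decreasing
    tie-breakers. Hence the color jumps at a cut, and as colors weakly increase along the word, the
    segment before it is a sublevel set of [phi]. *)
Lemma cut_sets_color S : S \in cut_sets pi ->
  exists2 j, j.+1 < m & S = [set v | phi v <= j].
Proof.
case/mapP=> c; case: (posnP d) => [d0|d_gt0].
  by rewrite /cuts (eq_filter (a2 := pred0)) ?filter_pred0 // => -[? ?]; lia.
rewrite mem_behead_cuts // mem_cuts => /andP[c_gt0 /existsP[k /andP[cut_k /eqP kc]]] ->.
subst c; move: cut_k; rewrite /is_cut eqn0Ngt c_gt0 /= => /existsP[j /andP[/eqP jk Hcut]].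
have ltjk : j < k by rewrite -jk.
have phi_lt : phi (pi j) < phi (pi k).
  by have := pi_sorted ltjk; rewrite /color_order !color_rankE; lia.
(* The threshold is the color of the last letter before the cut; the larger color just after it
   gives the strict bound by [m]. *)
exists (phi (pi j)); first exact: leq_ltn_trans (ltn_ord (phi (pi k))).
have phi_mono (a b : 'I_d) : a <= b -> phi (pi a) <= phi (pi b).
  rewrite leq_eqVlt => /orP[/eqP/val_inj -> //|/pi_sorted].
  by rewrite /color_order; lia.
apply/setP => v; rewrite in_block inE /= -(permKV pi v) permK.
case: ltnP => [|/phi_mono]; last by lia.
by rewrite -jk ltnS => /phi_mono ->.
Qed.

End Coloring.

Lemma coloring_cut_sets m (phi : {ffun 'I_d -> 'I_m}) : is_coloring e phi ->
  exists pi : 'S_d, forall S, S \in cut_sets pi ->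
    exists2 j, j.+1 < m & S = [set v | phi v <= j].
Proof.
move=> phi_col; have [pi pi_sorted] := exists_sorting_perm
  (color_order_total phi) (@color_order_trans _ phi).
by exists pi => S; apply: cut_sets_color.
Qed.

End Words.

Local Open Scope ring_scope.

Lemma count_ltn_iota a n : (a <= n)%N -> count (fun j => j < a)%N (iota 0 n) = a.
Proof.
move=> le_an; rewrite -(subnKC le_an) iotaD count_cat add0n.
rewrite (eq_in_count (a2 := predT)) => [|j]; last by rewrite mem_iota.
rewrite count_predT size_iota (eq_in_count (a2 := pred0)) => [|j].
  by rewrite count_pred0 addn0.
by rewrite mem_iota => /andP[le_aj _]; apply/negbTE; rewrite -leqNgt.
Qed.

(** * Monomials of the face ring and their exponents *)

Section Monomials.
Variables (k : fieldType) (d : nat).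
Implicit Types (S T : {set 'I_d}) (m : 'X_{1..nvars d}) (l : seq {set 'I_d}).

Local Notation proj := (@face_proj k d).

Definition sets_mnm l : 'X_{1..nvars d} := (\sum_(S <- l) U_(enum_rank S))%MM.

(** These are the exponents of the monomials that survive in the face ring. *)
Definition is_chain_mnm m := forall S T,
  (0 < m (enum_rank S))%N -> (0 < m (enum_rank T))%N ->
  (S \subset T) || (T \subset S).

Lemma sets_mnmE l T : sets_mnm l (enum_rank T) = count_mem T l.
Proof.
rewrite /sets_mnm mnm_sumE -sum1_count [RHS]big_mkcond /=.
by apply: eq_bigr => S _; rewrite mnm1E (inj_eq enum_rank_inj); case: eqP.
Qed.

Lemma sets_mnm_gt0 l T : (0 < sets_mnm l (enum_rank T))%N = (T \in l).
Proof. by rewrite sets_mnmE -has_count has_pred1. Qed.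

Lemma sets_mnm_perm l l' : sets_mnm l = sets_mnm l' -> perm_eq l l'.
Proof. by move=> eq_m; apply/allP => T _ /=; rewrite -!sets_mnmE eq_m. Qed.

Lemma mdeg_sets_mnm l : mdeg (sets_mnm l) = size l.
Proof.
rewrite /sets_mnm mdeg_sum -sum1_size.
by apply: eq_bigr => S _; rewrite mdeg1.
Qed.

Lemma sets_mnm_surj m : exists l, sets_mnm l = m.
Proof.
elim: {m}(mdeg m) {-2}m (erefl (mdeg m)) => [|a IH] m deg_m.
  by exists [::]; rewrite /sets_mnm big_nil; apply/esym/eqP; rewrite -mdeg_eq0 deg_m.
have [i m_i | m0] := pickP (fun i => 0 < m i)%N; last first.
  move: deg_m; rewrite mdegE big1 // => i _.
  by have := m0 i; case: (m i).
have le_im : (U_(i) <= m)%MM by rewrite lep1mP -lt0n.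
have [|l eq_l] := IH (m - U_(i))%MM.
  by move: deg_m; rewrite -{1}(submK le_im) mdegD mdeg1 addn1 => -[].
exists (enum_val i :: l).
by rewrite /sets_mnm big_cons -/(sets_mnm l) eq_l enum_valK addmC submK.
Qed.

(** Without repetition every exponent of [l] is at most 1, so mere occurrence in [l'] suffices. *)
Lemma uniq_sets_mnm_le l l' :
  uniq l -> {subset l <= l'} -> (sets_mnm l <= sets_mnm l')%MM.
Proof.
move=> uniq_l sub_l; apply/mnm_lepP => i; rewrite -(enum_valK i) !sets_mnmE.
rewrite count_uniq_mem //; case l_i: (_ \in l) => //.
by rewrite -has_count has_pred1 sub_l.
Qed.

Lemma face_projM (a b : subset_poly k d) : proj (a * b) = proj a * proj b.
Proof. exact: (rmorphM \pi_(face_ring k d)%qT). Qed.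

Lemma face_projD (a b : subset_poly k d) : proj (a + b) = proj a + proj b.
Proof. exact: (rmorphD \pi_(face_ring k d)%qT). Qed.

Lemma face_projK (r : face_ring k d) : exists a, r = proj a.
Proof. by exists (repr r); rewrite /face_proj reprK. Qed.

Lemma face_projP (a b : subset_poly k d) :
  proj a = proj b <-> a - b \in @face_ideal k d.
Proof. by rewrite Quotient.idealrBE; split=> [ab|/eqP //]; apply/eqP. Qed.

Lemma mcoeff_mulX_le (a : subset_poly k d) m0 m :
  (a * 'X_[m0])@_m != 0 -> (m0 <= m)%MM.
Proof.
rewrite mcoeff_eq0 negbK (perm_mem (msuppMX _ _)) => /mapP[m' _ ->].
exact: lem_addr.
Qed.

(** Every monomial in a multiple of a generator is divisible by two variables with incomparable
    index sets, which no chain monomial is. *)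
Lemma mcoeff_face_ideal (a : subset_poly k d) m :
  is_chain_mnm m -> a \in @face_ideal k d -> a@_m = 0.
Proof.
move=> chain_m /asboolP[s [gen_s ->]]; rewrite raddf_sum /= big_seq big1 // => p.
case/gen_s=> S [T [nST nTS ->]]; rewrite /pvar -mpolyXD.
apply/eqP; apply: contraT => /mcoeff_mulX_le/mnm_lepP le_m.
suff : (S \subset T) || (T \subset S) by rewrite (negbTE nST) (negbTE nTS).
by apply: chain_m; apply: leq_trans (le_m _); rewrite mnmDE !mnm1E eqxx ?addn1.
Qed.

Lemma face_proj_eq0 m : ~ is_chain_mnm m -> proj 'X_[m] = 0.
Proof.
move=> nchain; rewrite -(rmorph0 \pi_(face_ring k d)%qT); apply/face_projP.
rewrite subr0; apply: contra_notT nchain => nI S T S_m T_m.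
apply: contraNT nI; rewrite negb_or => /andP[nST nTS].
(* Distinctness ensures that exponents at least 1 at [S] and at [T] suffice for the product of the
   two variables to divide [m]. *)
have neST : S != T by apply: contraNneq nST => ->.
have le_m : (U_(enum_rank S) + U_(enum_rank T) <= m)%MM.
  apply/mnm_lepP => i; rewrite mnmDE !mnm1E.
  case: eqP => [<-|_]; last by case: eqP => [<-|].
  by rewrite (inj_eq enum_rank_inj) eq_sym (negbTE neST).
pose q : subset_poly k d := 'X_[m - (U_(enum_rank S) + U_(enum_rank T))].
apply/asboolP; exists [:: (q, pvar k S * pvar k T)].
split=> [p|]; first by rewrite inE => /eqP ->; exists S, T.
by rewrite big_seq1 /q /pvar -!mpolyXD submK.
Qed.

Lemma face_proj_neq0 m : is_chain_mnm m -> proj 'X_[m] != 0.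
Proof.
move=> chain_m; apply/eqP; rewrite -(rmorph0 \pi_(face_ring k d)%qT) => /face_projP.
move/(mcoeff_face_ideal chain_m)/eqP.
by rewrite subr0 mcoeffX eqxx oner_eq0.
Qed.

Lemma face_proj_inj m m' :
  is_chain_mnm m -> proj 'X_[m] = proj 'X_[m'] -> m = m'.
Proof.
move=> chain_m /face_projP/(mcoeff_face_ideal chain_m)/eqP.
rewrite mcoeffB !mcoeffX eqxx subr_eq0; case: (m' =P m) => [-> //|_].
by rewrite oner_eq0.
Qed.

Lemma prod_xvar l : \prod_(S <- l) xvar k S = proj 'X_[sets_mnm l].
Proof.
rewrite /sets_mnm; elim: l => [|S l IH].
  by rewrite !big_nil mpolyX0 /face_proj (rmorph1 \pi_(face_ring k d)%qT).
by rewrite !big_cons mpolyXD face_projM IH.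
Qed.

(* The coefficient of a chain monomial is well defined on the quotient. *)
Lemma chain_mnm_dvd (M : 'X_{1..nvars d} -> Prop) m
    (s : seq (face_ring k d * face_ring k d)) :
  is_chain_mnm m ->
  (forall p, p \in s -> exists m0 c, M m0 /\ p.2 = proj 'X_[m0] * c) ->
  proj 'X_[m] = \sum_(p <- s) p.1 * p.2 ->
  exists m0, M m0 /\ (m0 <= m)%MM.
Proof.
move=> chain_m M_s.
(* A lift [a] of the sum is built summand by summand, so a nonzero coefficient at [m] traces back to
   a multiple of some ['X_[m0]]. Comparison with ['X_[m]] modulo the ideal then shows that this
   coefficient is 1. *)
have [a [<- a_m]] : exists a, proj a = \sum_(p <- s) p.1 * p.2 /\
    (a@_m != 0 -> exists m0, M m0 /\ (m0 <= m)%MM).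
  elim: s M_s => [|p s IH] M_s.
    exists 0; rewrite big_nil mcoeff0 eqxx; split=> //.
    exact: (rmorph0 \pi_(face_ring k d)%qT).
  have [q q_s|a [a_s a_m]] := IH; first by apply: M_s; rewrite inE q_s orbT.
  have [|m0 [c [M_m0 p2E]]] := M_s p; first exact: mem_head.
  have [[b bE] [c' cE]] := (face_projK p.1, face_projK c).
  exists (b * c' * 'X_[m0] + a); split.
    rewrite big_cons face_projD a_s p2E bE cE !face_projM.
    by rewrite -mulrA [_ * proj c']mulrC.
  rewrite mcoeffD; have [->|] := eqVneq ((b * c' * 'X_[m0])@_m) 0.
    by rewrite add0r.
  by move=> /mcoeff_mulX_le le_m _; exists m0.
move/face_projP/(mcoeff_face_ideal chain_m)/eqP.
rewrite mcoeffB mcoeffX eqxx subr_eq0 => /eqP am1.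
by apply: a_m; rewrite -am1 oner_eq0.
Qed.

(** * Chain monomials in the coloring ideal *)

Variable e : rel 'I_d.
Hypothesis d_gt0 : (0 < d)%N.

(** A short G-sequence determines its partial unions, so the sets of a basic coloring monomial can
    only be the cut sets of the word. *)
Lemma basic_coloring_monomialP (r : face_ring k d) :
  basic_coloring_monomial e r <->
  exists pi : 'S_d, r = proj 'X_[sets_mnm (cut_sets e pi)].
Proof.
have sub_s s :
    path (fun S T : {set 'I_d} => S \proper T) set0 (rcons s [set: 'I_d]%SET) ->
    path (fun S T : {set 'I_d} => S \subset T) set0 s.
  rewrite rcons_path => /andP[p_s _].
  by apply: sub_path p_s => S T; apply: proper_sub.
split=> [[s [p_s [pi eq_s] ->]]|[pi ->]].
  exists pi; rewrite prod_xvar; congr (proj 'X_[sets_mnm _]).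
  apply: pairmap_setD_inj (sub_s _ p_s) (sub_s _ (path_cut_sets e pi d_gt0)) _.
  by rewrite -short_GseqE // eq_s.
exists (cut_sets e pi); split; first exact: path_cut_sets.
  by exists pi; apply: short_GseqE.
by rewrite prod_xvar.
Qed.

Lemma coloring_ideal_mnm m : is_chain_mnm m ->
  coloring_ideal e (proj 'X_[m]) <->
  exists pi : 'S_d, (sets_mnm (cut_sets e pi) <= m)%MM.
Proof.
move=> chain_m; split=> [[s [s_col m_s]]|[pi le_m]].
  pose M m0 := exists pi : 'S_d, m0 = sets_mnm (cut_sets e pi).
  have [|m0 [[pi ->] le_m]] := chain_mnm_dvd (M := M) chain_m _ m_s.
    move=> p /s_col[_ [b [c [/basic_coloring_monomialP[pi ->] ->]]]].
    by exists (sets_mnm (cut_sets e pi)), c; split=> //; exists pi.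
  by exists pi.
exists [:: (1, proj 'X_[m])]; rewrite big_seq1 mul1r; split=> // p.
rewrite inE => /eqP -> /=; split.
  by exists (mdeg m); split; [apply: face_proj_neq0 | exists m].
exists (proj 'X_[sets_mnm (cut_sets e pi)]).
exists (proj 'X_[m - sets_mnm (cut_sets e pi)]); split.
  by apply/basic_coloring_monomialP; exists pi.
by rewrite -face_projM -mpolyXD addmC submK.
Qed.

End Monomials.

(** * Colorings as chains of subsets *)

Section ColorSets.
Variables (d n : nat) (phi : {ffun 'I_d -> 'I_n.+1}).

(** Level [n] is omitted, as it would always give the whole vertex set. Repeated sets, the empty set
    and the whole set may occur. *)
Definition color_sets : seq {set 'I_d} :=
  [seq [set v | (phi v <= j)%N] | j <- iota 0 n].

Lemma size_color_sets : size color_sets = n.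
Proof. by rewrite size_map size_iota. Qed.

Lemma color_sets_chain : is_chain_mnm (sets_mnm color_sets).
Proof.
move=> S T; rewrite !sets_mnm_gt0 => /mapP[i _ ->] /mapP[j _ ->].
wlog le_ij : i j / (i <= j)%N.
  by move=> wlog_ij; case: (leqP i j) => [|/ltnW] /wlog_ij //; rewrite orbC.
by apply/orP; left; apply/subsetP => v; rewrite !inE => /leq_trans; apply.
Qed.

(** The levels missing [v] are those below its color, so the multiset of sets remembers the
    coloring. *)
Lemma count_color_sets v :
  count (fun S : {set 'I_d} => v \notin S) color_sets = phi v.
Proof.
rewrite count_map -[RHS](@count_ltn_iota _ n); last exact: ltn_ord (phi v).
by apply: eq_count => j; rewrite /= inE -ltnNge.
Qed.

End ColorSets.

Lemma sets_mnm_color_sets_inj (d n : nat) :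
  injective (fun phi : {ffun 'I_d -> 'I_n.+1} => sets_mnm (color_sets phi)).
Proof.
move=> phi psi /sets_mnm_perm/seq.permP eq_count.
by apply/ffunP => v; apply: val_inj; rewrite /= -!count_color_sets eq_count.
Qed.

(** Sort the sets by inclusion and color each vertex by the index of the first set containing it;
    nesting puts the vertex in all later sets. *)
Lemma chain_mnm_color_sets (d n : nat) (m : 'X_{1..nvars d}) :
  is_chain_mnm m -> mdeg m = n ->
  exists phi : {ffun 'I_d -> 'I_n.+1}, sets_mnm (color_sets phi) = m.
Proof.
move=> chain_m deg_m; have [l0 l0E] := sets_mnm_surj m.
pose l := sort (fun S T : {set 'I_d} => S \subset T) l0.
have lE : sets_mnm l = m.
  by rewrite -l0E; apply: perm_big; rewrite perm_sort.
have l_sorted : sorted (fun S T : {set 'I_d} => S \subset T) l.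
  apply: (@sort_sorted_in _ (mem l0)); last by apply/allP.
  by move=> S T; rewrite -!sets_mnm_gt0 l0E; apply: chain_m.
have size_l : size l = n by rewrite -mdeg_sets_mnm lE.
(* If no set contains [v], [find] returns the length [n], which is the last color. *)
have lt_find v : (find (fun S : {set 'I_d} => v \in S) l < n.+1)%N.
  by rewrite ltnS -size_l find_size.
exists [ffun v => Ordinal (lt_find v)]; rewrite -lE; congr sets_mnm.
apply: (@eq_from_nth _ set0) => [|j]; first by rewrite size_color_sets.
rewrite size_color_sets => ltjn; rewrite (nth_map 0%N) ?size_iota //.
rewrite nth_iota // add0n; apply/setP => v; rewrite inE ffunE /=.
apply/idP/idP => [le_find|]; last first.
  by move=> v_j; rewrite leqNgt; apply/negP => /(before_find set0); rewrite v_j.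
have has_v : has (fun S : {set 'I_d} => v \in S) l.
  by rewrite has_find size_l (leq_ltn_trans le_find).
apply: subsetP (nth_find set0 has_v).
have tr : transitive (fun S T : {set 'I_d} => S \subset T).
  by move=> S T U; apply: subset_trans.
apply: (sorted_leq_nth tr (fun S => subxx S)) => //; rewrite inE size_l //.
exact: leq_ltn_trans ltjn.
Qed.

(** * The bijection between colorings and monomials *)

Theorem theorem2p3 (k : fieldType) (d : nat) (e : rel 'I_d)
    (hd : (0 < d)%N) (e_sym : symmetric e) (e_irr : irreflexive e) (n : nat) :
  exists f : {ffun 'I_d -> 'I_n.+1} -> face_ring k d,
    set_bij [set phi | is_coloring e phi]%classic
            [set r | is_monomial n r /\ coloring_ideal e r]%classic
            f.
Proof.
exists (fun phi => face_proj 'X_[sets_mnm (color_sets phi)]).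
have chain_phi := @color_sets_chain d n; split.
- move=> phi /= phi_col; split.
    split; first exact: face_proj_neq0.
    exists (sets_mnm (color_sets phi)).
    by rewrite mdeg_sets_mnm size_color_sets.
  apply/(coloring_ideal_mnm k e hd (chain_phi phi)).
  have [pi cut_pi] := coloring_cut_sets phi_col; exists pi.
  apply: uniq_sets_mnm_le => [|S /cut_pi[j ltjn ->]]; last first.
    by apply: map_f; rewrite mem_iota.
  (* Strict inclusions make the cut sets pairwise distinct. *)
  have := path_cut_sets e pi hd; rewrite rcons_path => /andP[/path_sorted + _].
  by apply: sorted_uniq => [S T U|S]; [apply: proper_trans | rewrite properxx].
- move=> phi psi _ _ /= /(face_proj_inj (chain_phi phi)).
  exact: sets_mnm_color_sets_inj.
- move=> r /= [[r_neq0 [m [deg_m r_m]]]]; subst r.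
  have chain_m : is_chain_mnm m.
    by apply: contrapT => /(face_proj_eq0 k) m0; rewrite m0 eqxx in r_neq0.
  move/(coloring_ideal_mnm k e hd chain_m) => [pi /mnm_lepP le_m].
  have [phi phiE] := chain_mnm_color_sets chain_m deg_m.
  exists phi; last by rewrite phiE.
  (* Divisibility makes every cut set a sublevel set of [phi], hence a union of color classes. *)
  apply: (coloring_of_cut_sets (pi := pi)) => // S x y S_pi eq_phi.
  have : S \in color_sets phi.
    rewrite -sets_mnm_gt0 phiE; apply: leq_trans (le_m _).
    by rewrite sets_mnm_gt0.
  by case/mapP=> j _ ->; rewrite !inE eq_phi.
Qed.
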